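(* Let $(a_j)_{j\ge1}$ be a sequence with $a_j\to+0$, let $\{T_g: g\in G\}$ be a free ergodic action of an infinite countable amenable group $G$ by measure-preserving automorphisms of a standard probability space $(X,m)$, and let $(F_j)_{j\ge1}$ be a sequence of finite subsets of $G$. Then for every measurable set $A'\subset X$ with $m(A')>0$ and every $\varepsilon>0$ there exists a measurable set $A\subset X$ with $m(A'\Delta A)<\varepsilon$ such that for all weights $w_{g,j}\ge 0$ ($j\ge 1$, $g\in F_j$) with $\sum_{g\in F_j}w_{g,j}=1$ for every $j$, one has $$\left|\left\{j\,:\ \left\|\sum_{g\in F_j}w_{g,j}T_g\mathbf{1}_A-m(A)\right\|>a_j\right\}\right|=\infty .$$
   Context: A sequence $a_j\to+0$ is a sequence of positive real numbers tending to $0$. The sets $F_j$ are nonempty (as is implicit in the existence of weights summing to $1$). The action is free if for every $g\in G$ other than the identity, $m(\{x: T_gx=x\})=0$. The group $G$ is amenable if there is a (Følner) sequence of finite subsets of $G$ that is asymptotically invariant under group shifts. The induced action on functions is normalized so that $T_g\mathbf{1}_A=\mathbf{1}_{T_gA}$, i.e. $T_gf(x)=f(T_g^{-1}x)$. The norm $\|\cdot\|$ is the norm of $L_1(X,m)$, $\mathbf{1}_A$ is the indicator function of $A$, $m(A)$ inside the norm denotes the constant function with that value, $\Delta$ denotes symmetric difference, and $|\cdot|$ applied to a set denotes its cardinality. *)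

(* Defs.v *)
From HB Require Import structures.
From mathcomp Require Import all_boot all_order all_algebra finmap.
From mathcomp Require Import all_classical all_reals all_analysis.

Set Implicit Arguments.
Unset Strict Implicit.
Unset Printing Implicit Defensive.
Import Order.TTheory GRing.Theory Num.Theory.
Import numFieldNormedType.Exports.

Local Open Scope classical_set_scope.
Local Open Scope ring_scope.

(* Membership in the domain of the completion of mu. *)
Definition completion_measurable d (Y : measurableType d) (R : realType)
    (mu : set Y -> \bar R) (A : set Y) : Prop :=
  exists B C : set Y,
    [/\ measurable B, measurable C, B `<=` A, A `<=` C & mu (C `\` B) = 0%E].

(* A Hausdorff pseudometric is a metric. *)
Definition polish (R : realType) (Y : completePseudoMetricType R) : Prop :=
  hausdorff_space Y /\ @second_countable Y.

(* (X, m) is isomorphic mod 0 to a Polish space carrying a (completed) Borel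
   probability measure, namely the image of m.  This covers both standard Borel
   spaces (X Polish with its Borel sigma-algebra, X0 = X, f = id) and complete
   Lebesgue-Rokhlin spaces; asking f @` A to be measurable only for the completed
   image measure makes the notion insensitive to whether m is complete. *)
Definition standard_probability d (X : measurableType d) (R : realType)
    (m : probability X R) : Prop :=
  exists (Y : completePseudoMetricType R)
         (f : X -> g_sigma_algebraType (@open Y)) (X0 : set X),
    [/\ polish Y,
        measurable X0 /\ m X0 = 1%E,
        measurable_fun [set: X] f,
        {in X0 &, injective f} &
        forall A : set X, measurable A -> A `<=` X0 ->
          completion_measurable (pushforward m f) (f @` A)].

Section Amenability.
Variable G : groupType.

Definition ltranslate (g : G) (K : {fset G}) : {fset G} :=
  [fset (g * x)%g | x in K]%fset.

Definition fsymdiff (K L : {fset G}) : {fset G} :=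
  ((K `\` L) `|` (L `\` K))%fset.

Definition folner (R : realType) (K : nat -> {fset G}) : Prop :=
  (forall n, K n != fset0) /\
  forall g : G,
    (#|` fsymdiff (ltranslate g (K n)) (K n)|%:R / #|` K n|%:R : R)
      @[n --> \oo] --> (0 : R).

Definition amenable (R : realType) : Prop :=
  exists K : nat -> {fset G}, folner R K.

End Amenability.

Section Actions.
Context d (X : measurableType d) (R : realType) (m : probability X R).
Context (G : groupType) (T : G -> X -> X).

(* Each T g is invertible, with inverse T g^-1, by the two action axioms. *)
Record mp_action : Prop := MpAction {
  mp_act1 : forall x, T 1%g x = x;
  mp_actM : forall g h x, T (g * h)%g x = T g (T h x);
  mp_act_measurable : forall g, measurable_fun [set: X] (T g);
  mp_act_preserving :
    forall g (A : set X), measurable A -> m (T g @^-1` A) = m A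
}.

Definition free_action : Prop :=
  forall g : G, g != 1%g -> m.-negligible [set x | T g x = x].

Definition ergodic_action : Prop :=
  forall A : set X, measurable A -> (forall g, T g @^-1` A = A) ->
    m A = 0%E \/ m A = 1%E.

(* Normalised so that koopman g \1_A = \1_(T g @` A). *)
Definition koopman (g : G) (f : X -> R) : X -> R := fun x => f (T g^-1%g x).

End Actions.

(* Main.v *)
Require Import Defs.
From HB Require Import structures.
From mathcomp Require Import all_boot all_order all_algebra finmap.
From mathcomp Require Import all_classical all_reals all_analysis.
From mathcomp Require Import measurable_realfun zify lra.

Set Implicit Arguments.
Unset Strict Implicit.
Unset Printing Implicit Defensive.
Import Order.TTheory GRing.Theory Num.Theory.
Import numFieldNormedType.Exports.

Local Open Scope classical_set_scope.
Local Open Scope ring_scope.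

(** The idea is to make the averages vanish on a set that is not too small.  If [C] is
    such that [A] misses every [T_g^-1 C], [g] in [F_j], then each [T_g 1_A] vanishes on
    [C], and so does every weighted average of them; hence the distance in [L^1] from
    that average to the constant [m A] is at least [m A * m C], for all weights at once
    ([Lnorm1_average_ge]).  So it is enough to remove from [A'] the union over [k] of the
    sets [B_k], the union of the [T_g^-1 C_k] over [g] in [F_(j_k)], where [m C_k] beats
    [a_(j_k)] and the [B_k] have small total measure.  The measures [delta_k] of the
    [C_k] are fixed first and [j_k] is chosen afterwards, with [a_(j_k)] tiny compared
    to [delta_k]; this works because [m B_k] is bounded by [2 * delta_k] whatever the
    finite set [F_(j_k)] is.

    What carries the proof is thus [almost_invariant_set]: for a finite set [S] of group
    elements and [0 <= delta <= 1/2], some [C] of measure [delta] has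
    [m (spread S C) <= 2 * delta].  Start from a set [L] with
    [m (spread S L \ L) <= m L < delta], for instance the empty set, and let [K] be a
    Folner set, almost invariant under the inverses of the elements of [S].  As [L] fills
    less than half of the space, a set of positive measure consists of points at least
    half of whose translates by [K] lie outside [L]; take in it a tiny [E] of positive
    measure and let [f x] count the [k] in [K] with [T_k^-1 x] in [E].  Then
    [f o T_g - f] is small in [L^1] compared with the part of [f] that lives outside [L].
    Both quantities are sums over the levels [P_t = {f > t}], so for one [t] the set
    [spread S P_t \ P_t] is smaller than [P_t \ L], and [P_t] may be added to [L]
    ([almost_invariant_enlarge]).  Exhaustion makes the measure reach [delta].

    Tiny sets [E] exist because there are no atoms: in a standard space an atom would be a
    point of positive mass ([standard_atomless]), and a free action of an infinite group
    would give it infinitely many translates of equal mass ([free_action_point_null]). *)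

(** * Counting and exhaustion for probability measures *)

Section RealMeasure.
Context d (X : measurableType d) (R : realType) (m : probability X R).
Implicit Types A B : set X.

Definition rmeasure A : R := fine (m A).

Lemma rmeasureE A : measurable A -> (rmeasure A)%:E = m A.
Proof. by move=> mA; rewrite fineK// fin_num_measure. Qed.

Lemma rmeasure_ge0 A : 0 <= rmeasure A.
Proof. by rewrite fine_ge0. Qed.

Lemma rmeasure_le A B : measurable A -> measurable B -> A `<=` B ->
  rmeasure A <= rmeasure B.
Proof.
by move=> mA mB AB; rewrite -lee_fin !rmeasureE// le_measure// inE.
Qed.

Lemma rmeasureT : rmeasure setT = 1.
Proof. by rewrite /rmeasure probability_setT. Qed.

Lemma rmeasure0 : rmeasure set0 = 0.
Proof. by rewrite /rmeasure measure0. Qed.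

Lemma rmeasureDI A B : measurable A -> measurable B ->
  rmeasure A = rmeasure (A `\` B) + rmeasure (A `&` B).
Proof.
move=> mA mB; apply: EFin_inj; rewrite EFinD !rmeasureE//;
  [exact: measureDI|exact: measurableI|exact: measurableD].
Qed.

Lemma rmeasureUD A B : measurable A -> measurable B ->
  rmeasure (A `|` B) = rmeasure A + rmeasure (B `\` A).
Proof.
move=> mA mB; rewrite (@rmeasureDI (A `|` B) A)//; last exact: measurableU.
by rewrite addrC setUK; congr (_ + _); rewrite setDUl setDv set0U.
Qed.

Lemma sum_indicE (I : Type) (r : seq I) (A : I -> set X) :
  (forall i, measurable (A i)) ->
  (\int[m]_x (\sum_(i <- r) \1_(A i) x)%:E =
   (\sum_(i <- r) rmeasure (A i))%:E)%E.
Proof.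
move=> mA; under eq_integral do rewrite -sumEFin.
rewrite ge0_integral_sum//=.
- rewrite -sumEFin; apply: eq_bigr => i _.
  by rewrite integral_indic// setIT rmeasureE.
- by move=> i; apply/measurable_EFinP; apply: measurable_indic.
Qed.

(** Double counting.  All comparisons of measures through multiplicities, that is through
    integrals of integer-valued functions, are instances of this one. *)
Lemma sum_rmeasure_le (I J : Type) (r : seq I) (s : seq J)
    (A : I -> set X) (B : J -> set X) :
  (forall i, measurable (A i)) -> (forall j, measurable (B j)) ->
  (forall x, (\sum_(i <- r) (x \in A i) <= \sum_(j <- s) (x \in B j))%N) ->
  \sum_(i <- r) rmeasure (A i) <= \sum_(j <- s) rmeasure (B j).
Proof.
move=> mA mB AB; rewrite -lee_fin -!sum_indicE//.
apply: ge0_le_integral => //.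
- by move=> x _; rewrite lee_fin sumr_ge0.
- apply/measurable_EFinP; apply: measurable_sum => i; exact: measurable_indic.
- apply/measurable_EFinP; apply: measurable_sum => i; exact: measurable_indic.
- move=> x _; rewrite lee_fin.
  under eq_bigr do rewrite indicE.
  under [leRHS]eq_bigr do rewrite indicE.
  by rewrite -!natr_sum ler_nat.
Qed.

Lemma rmeasure_nondecreasing_bigcup_le (U : nat -> set X) (c : R) :
  (forall n, measurable (U n)) -> (forall n, U n `<=` U n.+1) ->
  (forall n, rmeasure (U n) <= c) -> rmeasure (\bigcup_n U n) <= c.
Proof.
move=> mU U_ndec Uc.
have mbU : measurable (\bigcup_n U n) by exact: bigcupT_measurable.
have cvgU : m (U n) @[n --> \oo] --> m (\bigcup_n U n).
  apply: nondecreasing_cvg_mu => //.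
  by apply/nondecreasing_seqP => n; apply/subsetPset.
rewrite -lee_fin rmeasureE// -(cvg_lim _ cvgU)//.
apply: lime_le; first by apply/cvg_ex; exists (m (\bigcup_n U n)).
by apply: nearW => n; rewrite -rmeasureE// lee_fin.
Qed.

(** Greedy exhaustion: each term of an increasing sequence realizes at least half
    of the gain in measure still available.  If the union could be enlarged by some
    [c > 0], each step would have gained at least [c / 2]. *)
Lemma exhaustion (P : set X -> Prop) (delta : R) :
  (forall A, P A -> measurable A) ->
  (forall U : nat -> set X, (forall n, P (U n)) -> (forall n, U n `<=` U n.+1) ->
    P (\bigcup_n U n)) ->
  (forall A, P A -> rmeasure A < delta ->
    exists B, [/\ P B, A `<=` B & rmeasure A < rmeasure B]) ->
  P set0 -> exists2 A, P A & delta <= rmeasure A.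
Proof.
move=> Pm Pcup Pext P0.
pose above A : set R := [set r | exists B, [/\ P B, A `<=` B & r = rmeasure B]].
have above_ub A : ubound (above A) 1.
  move=> _ [B [PB _ ->]]; rewrite -rmeasureT.
  by apply: rmeasure_le => //; exact: Pm.
have above_sup A B : P B -> A `<=` B -> rmeasure B <= sup (above A).
  move=> PB AB; apply: ub_le_sup; first by exists 1; exact: above_ub.
  by exists B.
have step (A : {A | P A}) : exists B : {A | P A},
    sval A `<=` sval B /\
    sup (above (sval A)) <= rmeasure (sval B) *+ 2 - rmeasure (sval A).
  case: A => A PA /=.
  have := above_sup A A PA (@subset_refl _ A).
  rewrite le_eqVlt => /orP[/eqP supE|supA].
    by exists (exist _ A PA); split => //=; rewrite -supE mulr2n addrK.
  have gap_gt0 : 0 < (sup (above A) - rmeasure A) / 2 by lra.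
  have [|_ [B [PB AB ->]] supB] := @sup_adherent _ (above A) _ gap_gt0.
    split; first by exists (rmeasure A); exists A; split.
    by exists 1; exact: above_ub.
  by exists (exist _ B PB); split => //=; rewrite mulr2n; lra.
pose U n := iter n (fun Q => sval (cid (step Q))) (exist P set0 P0).
have PU n : P (sval (U n)) by exact: svalP.
have [U_ndec U_gain] : (forall n, sval (U n) `<=` sval (U n.+1)) /\
    (forall n, sup (above (sval (U n))) <=
       rmeasure (sval (U n.+1)) *+ 2 - rmeasure (sval (U n))).
  by split=> n; rewrite /U/=; case: cid => B [].
have PV := Pcup _ PU U_ndec; set V := \bigcup_n _ in PV.
have subV n : sval (U n) `<=` V by move=> x Ux; exists n.
exists V => //; rewrite leNgt; apply/negP => V_delta.
have [C [PC VC]] := Pext _ PV V_delta; set c := rmeasure V => cC.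
have U_V n : rmeasure (sval (U n)) <= c.
  by apply: rmeasure_le; [exact: Pm|exact: Pm|exact: subV].
have U_lin n : n%:R * ((rmeasure C - c) / 2) <= rmeasure (sval (U n)).
  elim: n => [|n IHn]; first by rewrite mul0r rmeasure_ge0.
  have UC : sval (U n) `<=` C by apply: subset_trans VC; exact: subV.
  have := above_sup _ _ PC UC; have := U_gain n; have := U_V n.
  by rewrite -natr1 mulrDl mul1r mulr2n; lra.
have gap_gt0 : 0 < (rmeasure C - c) / 2 by lra.
have [n] : exists n, c < n%:R * ((rmeasure C - c) / 2).
  exists (Num.bound (c / ((rmeasure C - c) / 2))).
  rewrite -ltr_pdivrMr//; apply: archi_boundP.
  by rewrite divr_ge0 ?rmeasure_ge0// ltW.
by have := U_lin n; have := U_V n; lra.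
Qed.

End RealMeasure.

(** * Absence of atoms *)

Section Atomless.
Context d (X : measurableType d) (R : realType) (m : probability X R).
Context (G : groupType) (T : G -> X -> X) (Taction : mp_action m T).

Lemma action_cancel g x : T g^-1%g (T g x) = x.
Proof. by rewrite -(mp_actM Taction) mulVg (mp_act1 Taction). Qed.

Lemma action_cancelV g x : T g (T g^-1%g x) = x.
Proof. by rewrite -(mp_actM Taction) mulgV (mp_act1 Taction). Qed.

Lemma measurable_action_preimage g (A : set X) :
  measurable A -> measurable (T g @^-1` A).
Proof.
move=> mA; rewrite -[X in measurable X]setTI.
exact: (mp_act_measurable Taction).
Qed.

Lemma rmeasure_action_preimage g (A : set X) :
  measurable A -> rmeasure m (T g @^-1` A) = rmeasure m A.
Proof. by move=> mA; rewrite /rmeasure (mp_act_preserving Taction). Qed.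

(** The points of a free orbit are distinct and have equal masses. *)
Lemma free_action_point_null : infinite_set [set: G] -> free_action m T ->
  forall x, measurable [set x] -> rmeasure m [set x] = 0.
Proof.
move=> Ginf Tfree x mx; apply/eqP; rewrite eq_le rmeasure_ge0 andbT leNgt.
apply/negP => x_gt0.
have T_inj g h : T g x = T h x -> g = h.
  move=> gh; have [/mulg1_eq|/Tfree[N [mN N0 fixN]]] := eqVneq (g^-1 * h)%g 1%g.
    by rewrite invgK.
  suff : rmeasure m [set x] <= 0 by rewrite leNgt x_gt0.
  rewrite (_ : 0 = rmeasure m N); last by rewrite /rmeasure N0.
  apply: rmeasure_le => // _ ->; apply: fixN => /=.
  by rewrite (mp_actM Taction) -gh action_cancel.
pose orb g := T g^-1%g @^-1` [set x].
have orbE g y : (y \in orb g) = (y == T g x) :> bool.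
  apply/idP/eqP; first by rewrite inE => /= <-; rewrite action_cancelV.
  by move=> ->; rewrite inE /orb/= action_cancel.
have morb g : measurable (orb g) by exact: measurable_action_preimage.
have [B _ Bsize] := infinite_set_fset (Num.bound (rmeasure m [set x])^-1) Ginf.
have : \sum_(g <- B) rmeasure m (orb g) <= \sum_(i <- [:: tt]) rmeasure m setT.
  apply: sum_rmeasure_le => // y.
  rewrite big_seq1 in_setT; under eq_bigr do rewrite orbE.
  have [[g yE]|noty] := pselect (exists g, y = T g x); last first.
    rewrite big1// => g _; apply/eqP; rewrite eqb0.
    by apply/eqP => yE; apply: noty; exists g.
  rewrite (eq_bigr (fun h => (if h == g then 1 else 0)%N)).
    by rewrite -big_mkcond sum1_count count_uniq_mem ?fset_uniq ?leq_b1.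
  by move=> h _; rewrite yE (inj_eq (fun u v => @T_inj u v)) eq_sym; case: eqP.
rewrite big_seq1 rmeasureT; under eq_bigr do rewrite rmeasure_action_preimage//.
rewrite big_const_seq iter_addr_0 count_predT leNgt => /negP; apply.
have x_inv : (rmeasure m [set x])^-1 < #|` B|%:R.
  have := @archi_boundP R (rmeasure m [set x])^-1; rewrite invr_ge0 ltW//.
  by move=> /(_ isT)/lt_le_trans; apply; rewrite ler_nat.
by rewrite -(mulfV (lt0r_neq0 x_gt0)) -mulr_natr ltr_pM2l.
Qed.

(** By repeated halving, this is equivalent to the usual condition that every set of
    positive measure has a subset of positive and strictly smaller measure. *)
Definition atomless := forall (D : set X) (eta : R),
  measurable D -> 0 < rmeasure m D -> 0 < eta ->
  exists E, [/\ measurable E, E `<=` D, 0 < rmeasure m E & rmeasure m E < eta].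

(** Halving a set of positive measure along a countable basis, always keeping a half of
    positive measure, ends in a single point.  If no half had measure below [eta], that
    point would keep a mass of at least [eta]. *)
Lemma standard_atomless : standard_probability m ->
  (forall x, measurable [set x] -> rmeasure m [set x] = 0) -> atomless.
Proof.
move=> [Y [f [X0 [[Y_hausdorff [B Bcount [Bopen Bbasis]]] [mX0 X01] mf f_inj _]]]].
move=> points_null D eta mD D_gt0 eta_gt0; apply: contrapT => noE.
have large E : measurable E -> E `<=` D -> 0 < rmeasure m E -> eta <= rmeasure m E.
  by move=> mE ED E_gt0; rewrite leNgt; apply/negP => E_lt; apply: noE; exists E.
(* Numbering the basic open sets; numbers that are not used give the empty set. *)
have [rank rank_inj] := countable_injP _ Bcount.
pose O n := \bigcup_(U in [set U | B U /\ rank U = n]) U.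
have OE U : B U -> O (rank U) = U.
  move=> BU; apply/seteqP; split=> [y [V [BV rankV] Vy]|y Uy]; last by exists U.
  by rewrite -(rank_inj _ _ _ _ rankV)// inE.
have mO n : measurable (f @^-1` O n).
  rewrite -[X in measurable X]setTI; apply: mf => //.
  apply: sub_sigma_algebra; apply: bigcup_open => U [BU _]; exact: Bopen.
pose half n (A : set X) := if 0 < rmeasure m (A `&` f @^-1` O n)
  then A `&` f @^-1` O n else A `\` f @^-1` O n.
have halfP n (A : set X) : measurable A -> 0 < rmeasure m A ->
    [/\ measurable (half n A), half n A `<=` A & 0 < rmeasure m (half n A)].
  move=> mA A_gt0; rewrite /half; case: ifPn => [I_gt0|]; first split => //.
  - exact: measurableI.
  - rewrite -leNgt => I_le0; split; [exact: measurableD|by move=> x []|].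
    have := rmeasureDI m mA (mO n); have := rmeasure_ge0 m (A `&` f @^-1` O n).
    by move: I_le0 A_gt0; lra.
pose fix H n := if n is k.+1 then half k (H k) else D `&` X0.
have mX0C : rmeasure m (~` X0) = 0.
  by rewrite /rmeasure probability_setC// X01 subee.
have HP n : measurable (H n) /\ 0 < rmeasure m (H n).
  elim: n => [|n [mH H_gt0]] /=; last by have [] := halfP n _ mH H_gt0.
  split; first exact: measurableI.
  rewrite (rmeasureDI m mD mX0) in D_gt0.
  suff : rmeasure m (D `\` X0) <= 0 by move: D_gt0; lra.
  rewrite -mX0C; apply: rmeasure_le; [exact: measurableD|exact: measurableC|].
  by move=> x [].
have H_ndec n : H n.+1 `<=` H n by have [mH /(halfP n _ mH)[]] := HP n.
have HD n : H n `<=` D.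
  by elim: n => [x []|n IHn] //; apply: subset_trans IHn.
(* The complements increase, and their measures stay below [m D - eta]. *)
pose L := \bigcup_n (D `\` H n).
have mL : measurable L.
  by apply: bigcupT_measurable => n; apply: measurableD => //; case: (HP n).
have L_le : rmeasure m L <= rmeasure m D - eta.
  apply: rmeasure_nondecreasing_bigcup_le => n.
  - by apply: measurableD => //; case: (HP n).
  - by move=> x [Dx nHx]; split=> // /H_ndec.
  - have [mH H_gt0] := HP n; have := large _ mH (HD n) H_gt0.
    by rewrite (rmeasureDI m mD mH) (setIidr (@HD n)); lra.
have mDL : measurable (D `\` L) by exact: measurableD.
have DL_gt0 : 0 < rmeasure m (D `\` L).
  rewrite (rmeasureDI m mD mL) in L_le.
  have : rmeasure m (D `&` L) <= rmeasure m L.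
    by apply: rmeasure_le => //; exact: measurableI.
  by move: L_le eta_gt0; lra.
have DL_H n x : (D `\` L) x -> H n x.
  by move=> [Dx nLx]; apply: contrapT => nHx; apply: nLx; exists n.
have [x DLx] : (D `\` L) !=set0.
  by apply/set0P; apply/eqP => DL0; rewrite DL0 rmeasure0 ltxx in DL_gt0.
have DL1 : D `\` L = [set x].
  apply/seteqP; split => [y DLy|_ -> //].
  have [_ X0x] := DL_H 0%N _ DLx; have [_ X0y] := DL_H 0%N _ DLy.
  apply: f_inj; rewrite ?inE//; apply/eqP/negPn/negP => fyx.
  have [A [oA Ay Ax]] := hausdorff_accessible Y_hausdorff fyx.
  rewrite !inE in Ay Ax.
  have [U [BU Uy] UA] := Bbasis (f y) A (open_nbhs_nbhs (conj oA Ay)).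
  have := DL_H (rank U).+1 _ DLx; have := DL_H (rank U).+1 _ DLy.
  by rewrite /= /half OE//; case: ifP => _ [_ Ufy] [_ Ufx] //; apply: Ax; exact: UA.
by rewrite DL1 points_null -?DL1// ltxx in DL_gt0.
Qed.
End Atomless.

(** * Enlarging almost invariant sets *)

(** Left translations are by inverses, because counting the [k] in [K] with
    [T k^-1 (T g x)] in [E] amounts to counting over [g^-1 K] at the point [x]. *)
Lemma amenable_almost_invariant (R : realType) (G : groupType) (S : {fset G}) :
  amenable G R -> exists2 K : {fset G}, K != fset0 &
    (2 * \sum_(g <- S) #|` ltranslate g^-1 K `\` K|%fset < #|` K|)%N.
Proof.
move=> [K [K_neq0 K_inv]].
pose def n := \sum_(g <- S)
  (#|` fsymdiff (ltranslate g^-1 (K n)) (K n)|%:R / #|` K n|%:R : R).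
have def_cvg : def n @[n --> \oo] --> (0 : R).
  rewrite [X in _ --> X](_ : _ = \sum_(g <- S) 0); last by rewrite big1.
  apply: cvg_big; first exact: add_continuous.
  by move=> g _; exact: K_inv.
have [n _ /(_ n (leqnn n))/= def_n] :
    \forall n \near \oo, def n < 2^-1 by apply: cvgr_lt def_cvg _ _; rewrite invr_gt0.
exists (K n) => //.
have K_gt0 : (0 : R) < #|` K n|%:R by rewrite ltr0n cardfs_gt0.
rewrite -(ltr_nat R) natrM natr_sum mulrC -ltr_pdivlMr//.
move: def_n; rewrite /def -mulr_suml ltr_pdivrMr// mulrC; apply: le_lt_trans.
apply: ler_sum => g _; rewrite ler_nat.
by apply: fsubset_leq_card; rewrite /fsymdiff fsubsetUl.
Qed.

(** How level sets see the increment of a counting function from [a] to [b]; this is the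
    discrete form of the co-area formula. *)
Lemma sum_window (N a b : nat) :
  (\sum_(t < N) ((t < b) && ~~ (t < a)) <= b - a)%N.
Proof.
suff : (\sum_(t < N) ((t < b) && ~~ (t < a)) <= minn N b - minn N a)%N.
  by move=> /leq_trans; apply; lia.
elim: N => [|N IHN]; first by rewrite big_ord0.
rewrite big_ord_recr/=; move: IHN; set s := \sum_(_ < N) _ => IHN.
by case: (ltnP N b) => NB; case: (ltnP N a) => /= NA; lia.
Qed.

Lemma sum_below (N n : nat) : (n <= N)%N -> (\sum_(t < N) (t < n) = n)%N.
Proof.
move=> nN; rewrite -[RHS](minn_idPr nN); elim: N {nN} => [|N IHN].
  by rewrite big_ord0 min0n.
by rewrite big_ord_recr/= IHN; case: (ltnP N n) => NB/=; lia.
Qed.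

Lemma sum_fset_leD (I : choiceType) (A B : {fset I}) (F : I -> nat) :
  (\sum_(i <- A) F i <= \sum_(i <- B) F i + \sum_(i <- (A `\` B)%fset) F i)%N.
Proof.
rewrite (big_fsetID _ (mem B) A)/= (big_fsetID _ (mem A) B)/=.
rewrite (_ : [fset x in A | x \in B]%fset = [fset x in B | x \in A]%fset); last first.
  by apply/fsetP => x; rewrite !inE andbC.
rewrite (_ : [fset x in A | x \notin B]%fset = (A `\` B)%fset); last first.
  by apply/fsetP => x; rewrite !inE andbC.
by rewrite leq_add2r leq_addr.
Qed.

Section AlmostInvariant.
Context d (X : measurableType d) (R : realType) (m : probability X R).
Context (G : groupType) (T : G -> X -> X) (Taction : mp_action m T).

(** Preimages rather than images, because [koopman T g] evaluates at [T g^-1 x]: if [A]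
    misses [spread S C], each [koopman T g \1_A] with [g] in [S] vanishes on [C]. *)
Definition spread (S : {fset G}) (C : set X) : set X :=
  \bigcup_(g in [set` S]) (T g @^-1` C).

Lemma measurable_spread S C : measurable C -> measurable (spread S C).
Proof.
move=> mC; apply: fin_bigcup_measurable; first exact: finite_fset.
by move=> g _; exact: (measurable_action_preimage Taction).
Qed.

Lemma measurable_count (I : Type) (r : seq I) (A : I -> set X) (n : nat) :
  (forall i, measurable (A i)) ->
  measurable [set x | (n < \sum_(i <- r) (x \in A i))%N].
Proof.
move=> mA.
have mf : measurable_fun setT (fun x => \sum_(i <- r) \1_(A i) x : R).
  by apply: measurable_sum => i; exact: measurable_indic.
rewrite (_ : [set x | _] =
    setT `&` (fun x => \sum_(i <- r) \1_(A i) x : R) @^-1` `]n%:R, +oo[).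
  by apply: mf => //; exact: measurable_itv.
rewrite setTI; apply/seteqP.
have sumE x : \sum_(i <- r) \1_(A i) x = (\sum_(i <- r) (x \in A i))%N%:R :> R.
  by rewrite natr_sum; apply: eq_bigr => i _; rewrite indicE.
by split => x /=; rewrite in_itv/= andbT sumE ltr_nat.
Qed.

(** This is the co-area argument: the multiplicity [f] of the translates of [E] by [K] is
    almost invariant, and its mass outside [L] is at least half of its total mass; summing
    over the levels of [f] shows that some level set is almost invariant compared with
    what it adds to [L]. *)
Lemma almost_invariant_enlarge (S : {fset G}) (L : set X) (delta : R) :
  atomless m -> amenable G R -> delta <= 1 / 2 ->
  measurable L -> rmeasure m L < delta ->
  rmeasure m (spread S L `\` L) <= rmeasure m L ->
  exists L', [/\ measurable L', L `<=` L', rmeasure m L < rmeasure m L',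
    rmeasure m L' <= delta & rmeasure m (spread S L' `\` L') <= rmeasure m L'].
Proof.
move=> small Gam delta_le mL L_delta SL.
have [K K_neq0 KS] := amenable_almost_invariant S Gam.
set N := #|` K| in KS.
have N_gt0 : 0 < N%:R :> R by rewrite ltr0n cardfs_gt0.
have mTL k : measurable (T k @^-1` (~` L)).
  by apply: (measurable_action_preimage Taction) => //; exact: measurableC.
have mTL' k : measurable (T k @^-1` L) by exact: (measurable_action_preimage Taction).
(* Points at least half of whose translates by [K] lie outside [L]. *)
pose D := [set x | (N./2 < \sum_(k <- K) (x \in T k @^-1` (~` L)))%N].
have mD : measurable D by exact: measurable_count.
have D_gt0 : 0 < rmeasure m D.
  have : \sum_(k <- K) rmeasure m [set: X] <=
      \sum_(j <- [seq inl k | k <- K] ++ [seq inl k | k <- K] ++ [seq inr k | k <- K])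
        rmeasure m (match j with inl k => T k @^-1` L | inr _ => D end).
    apply: (@sum_rmeasure_le _ _ _ _ _ _ _ _ (fun=> setT)) => //.
      by case.
    move=> x; rewrite !big_cat/= !big_map.
    under eq_bigr do rewrite in_setT.
    rewrite sum1_size -/N !big_const_seq !iter_addn !count_predT !addn0 -/N.
    have : (\sum_(k <- K) (x \in T k @^-1` L) +
            \sum_(k <- K) (x \in T k @^-1` (~` L)) = N)%N.
      rewrite -big_split/= -[RHS]sum1_size; apply: eq_bigr => k _.
      by rewrite preimage_setC in_setC; case: (_ \in _).
    set c := (\sum_(k <- K) (x \in T k @^-1` L))%N => cN.
    have [|xD] := boolP (x \in D); first by rewrite mul1n; lia.
    have : ~~ (N./2 < \sum_(k <- K) (x \in T k @^-1` (~` L)))%N.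
      by apply/negP => xD'; rewrite notin_setE in xD.
    by move: cN; set c' := (X in (c + X)%N); lia.
  rewrite !big_cat/= !big_map.
  under [X in _ <= X + _ -> _]eq_bigr do rewrite (rmeasure_action_preimage Taction)//.
  under [X in _ <= _ + (X + _) -> _]eq_bigr do rewrite (rmeasure_action_preimage Taction)//.
  rewrite !big_const_seq !iter_addr_0 !count_predT -/N rmeasureT.
  rewrite -!mulrnDl -[in leLHS](mulr_natr 1) -[in leRHS]mulr_natr ler_pM2r//.
  by move: delta_le L_delta; lra.
(* This bound on [m E] keeps the union of the translates of [E] within [delta - m L]. *)
have eta_gt0 : 0 < (delta - rmeasure m L) / N%:R by rewrite divr_gt0// subr_gt0.
have [E [mE ED E_gt0 E_lt]] := small _ _ mD D_gt0 eta_gt0.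
have mTE k : measurable (T k @^-1` E) by exact: (measurable_action_preimage Taction).
pose f x := (\sum_(k <- K) (x \in T k^-1%g @^-1` E))%N.
have f_le x : (f x <= N)%N.
  by rewrite /f /N -[leqRHS]sum1_size; apply: leq_sum => k _; exact: leq_b1.
pose P t := [set x | (t < f x)%N].
have mP t : measurable (P t) by exact: measurable_count.
(* The mass of [f] outside [L] is at least half of its total mass [N * m E]. *)
have EK : rmeasure m E * N%:R <= 2 * \sum_(t < N) rmeasure m (P t `\` L).
  apply: (@le_trans _ _ (2 * \sum_(k <- K) rmeasure m (E `&` T k @^-1` (~` L)))).
    have : \sum_(k <- K) rmeasure m E <=
        \sum_(k <- K ++ K) rmeasure m (E `&` T k @^-1` (~` L)).
      apply: (@sum_rmeasure_le _ _ _ _ _ _ _ _ (fun=> E)) => // [k|x].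
        exact: measurableI.
      have [xE|xE] := boolP (x \in E); last by rewrite big1.
      rewrite sum1_size big_cat/= addnn -/N.
      have := ED x; rewrite -in_setE xE => /(_ isT).
      under [X in (_ < X)%N -> _]eq_bigr do rewrite -[X in nat_of_bool X]andTb -xE -in_setI.
      by rewrite /D/=; lia.
    rewrite big_cat/= -mulr2n mulr_natl => /(le_trans _); apply.
    by rewrite big_const_seq iter_addr_0 count_predT mulr_natr.
  rewrite ler_pM2l//.
  rewrite (eq_bigr (fun k => rmeasure m (T k^-1%g @^-1` E `&` ~` L))); last first.
    move=> k _; rewrite -(rmeasure_action_preimage Taction k^-1%g); last exact: measurableI.
    rewrite preimage_setI; congr (rmeasure m (_ `&` _)); apply/seteqP.
    by split=> x /=; rewrite (action_cancelV Taction).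
  apply: sum_rmeasure_le => [k|t|x]; [|exact: measurableD|].
    by apply: measurableI => //; exact: measurableC.
  have [xL|xL] := boolP (x \in L).
    by rewrite big1// => k _; rewrite in_setI in_setC xL andbF.
  rewrite (eq_bigr (fun k => (x \in T k^-1%g @^-1` E) : nat)); last first.
    by move=> k _; rewrite in_setI in_setC xL andbT.
  rewrite -/(f x) -(sum_below (f_le x)); apply: leq_sum => t _.
  rewrite in_setD xL andbT; case: ltnP => // tf.
  by rewrite lt0b inE.
(* [Q] lists, with repetitions, the elements by which the sets [g^-1 K] exceed [K]. *)
pose Q := flatten [seq enum_fset (ltranslate g^-1 K `\` K)%fset | g <- S].
have QN : (2 * size Q < N)%N.
  by rewrite size_flatten sumnE !big_map.
have fT g x : (f (T g x) <= f x +
    \sum_(h <- (ltranslate g^-1 K `\` K)%fset) (x \in T h^-1%g @^-1` E))%N.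
  have -> : f (T g x) = (\sum_(h <- ltranslate g^-1 K) (x \in T h^-1%g @^-1` E))%N.
    rewrite /ltranslate big_imfset/=; last by move=> a b _ _ /mulgI.
    apply: eq_bigr => k _; congr nat_of_bool.
    by rewrite invgM invgK; apply/idP/idP; rewrite !inE/= (mp_actM Taction).
  exact: sum_fset_leD.
have sQ : \sum_(t < N) rmeasure m (spread S (P t) `\` P t) <= rmeasure m E * (size Q)%:R.
  have : \sum_(t < N) rmeasure m (spread S (P t) `\` P t) <=
      \sum_(h <- Q) rmeasure m (T h^-1%g @^-1` E).
    apply: sum_rmeasure_le => // [t|x].
      by apply: measurableD => //; exact: measurable_spread.
    rewrite big_flatten big_map.
    apply: (@leq_trans (\sum_(g <- S) (f (T g x) - f x))); last first.
      by apply: leq_sum => g _; rewrite leq_subLR.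
    apply:
      (@leq_trans (\sum_(g <- S) \sum_(t < N) ((t < f (T g x)) && ~~ (t < f x))));
      last first.
      by apply: leq_sum => g _; exact: sum_window.
    rewrite exchange_big; apply: leq_sum => t _ /=.
    have [|//] := boolP (x \in _); rewrite inE => -[[g gS /= Pgx] nPx].
    rewrite (big_fsetD1 g)//=; rewrite /P/= in Pgx nPx.
    by rewrite Pgx; move/negP: nPx => ->.
  under [X in _ <= X -> _]eq_bigr do rewrite (rmeasure_action_preimage Taction)//.
  by rewrite big_const_seq iter_addr_0 count_predT mulr_natr.
have [t t_gain] : exists t : 'I_N,
    rmeasure m (spread S (P t) `\` P t) < rmeasure m (P t `\` L).
  apply: contrapT => noT.
  have : \sum_(t < N) rmeasure m (P t `\` L) <=
      \sum_(t < N) rmeasure m (spread S (P t) `\` P t).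
    by apply: ler_sum => t _; rewrite leNgt; apply/negP => ?; apply: noT; exists t.
  move=> /le_trans/(_ sQ) PQ.
  have : rmeasure m E * N%:R <= rmeasure m E * (2 * size Q)%:R.
    by apply: le_trans EK _; rewrite natrM mulrCA ler_pM2l.
  by rewrite ler_pM2l// ler_nat leqNgt QN.
have mSP : measurable (spread S (P t)) by exact: measurable_spread.
have mSL : measurable (spread S L) by exact: measurable_spread.
have LP := rmeasureUD m mL (mP t).
have mLP : measurable (L `|` P t) by exact: measurableU.
exists (L `|` P t); split => //.
- by rewrite LP ltrDl; apply: le_lt_trans t_gain; exact: rmeasure_ge0.
- suff : rmeasure m (P t `\` L) <= delta - rmeasure m L by rewrite LP; lra.
  apply: (@le_trans _ _ (\sum_(k <- K) rmeasure m (T k^-1%g @^-1` E))); last first.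
    under eq_bigr do rewrite (rmeasure_action_preimage Taction)//.
    rewrite big_const_seq iter_addr_0 count_predT -mulr_natr.
    by rewrite -ler_pdivlMr// ltW.
  rewrite -[leLHS](big_seq1 +%R tt (fun=> rmeasure m (P t `\` L))).
  apply: sum_rmeasure_le => // [_|x]; first exact: measurableD.
  rewrite big_seq1; have [|//] := boolP (x \in _); rewrite inE => -[Px _].
  exact: leq_ltn_trans (leq0n t) Px.
- rewrite LP.
  apply: (@le_trans _ _ (rmeasure m ((spread S L `\` L) `|` (spread S (P t) `\` P t)))).
    apply: rmeasure_le.
    + by apply: measurableD => //; exact: measurable_spread.
    + by apply: measurableU; exact: measurableD.
    + move=> x [[g gS [Lx|Px]] /not_orP[nLx nPx]]; [left|right]; split => //;
      by exists g.
  rewrite rmeasureUD; [|exact: measurableD..]; apply: lerD => //.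
  apply: le_trans (ltW t_gain); apply: rmeasure_le; [|exact: measurableD|by move=> x []].
  by apply: measurableD; exact: measurableD.
Qed.
End AlmostInvariant.

(** * Almost invariant sets and averages *)

Section AlmostInvariantSet.
Context d (X : measurableType d) (R : realType) (m : probability X R).
Context (G : groupType) (T : G -> X -> X) (Taction : mp_action m T).

(** Almost invariance passes to increasing unions, so that exhaustion applies to
    [almost_invariant_enlarge] and stops only at measure [delta]. *)
Lemma almost_invariant_set (S : {fset G}) (delta : R) :
  atomless m -> amenable G R -> 0 <= delta -> delta <= 1 / 2 ->
  exists C, [/\ measurable C, rmeasure m C = delta &
    rmeasure m (spread T S C) <= 2 * delta].
Proof.
move=> small Gam delta_ge0 delta_le.
pose P C := [/\ measurable C, rmeasure m C <= delta &
  rmeasure m (spread T S C `\` C) <= rmeasure m C].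
have spreadP C : measurable C -> measurable (spread T S C).
  exact: (measurable_spread Taction).
have [| | | |C [mC C_le SC] C_ge] := @exhaustion _ _ _ m P delta.
- by move=> A [].
- move=> U PU U_ndec.
  have mU n : measurable (U n) by case: (PU n).
  have mV : measurable (\bigcup_n U n) by exact: bigcupT_measurable.
  split=> //.
    by apply: rmeasure_nondecreasing_bigcup_le => // n; case: (PU n).
  have -> : spread T S (\bigcup_n U n) `\` \bigcup_n U n =
      \bigcup_n (spread T S (U n) `\` \bigcup_n U n).
    apply/seteqP; split=> [x [[g gS [n _ Ux]] nVx]|x [n _ [[g gS Ux] nVx]]].
      by exists n => //; split=> //; exists g.
    by split=> //; exists g => //; exists n.
  apply: rmeasure_nondecreasing_bigcup_le => n.
  + by apply: measurableD => //; exact: spreadP.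
  + by move=> x [[g gS Ux] nVx]; split=> //; exists g => //; exact: U_ndec.
  + have [_ _ SU] := PU n; apply: le_trans (le_trans SU _).
      apply: rmeasure_le; [|by apply: measurableD => //; exact: spreadP|].
        by apply: measurableD => //; exact: spreadP.
      by move=> x [Sx nVx]; split=> // Ux; apply: nVx; exists n.
    by apply: rmeasure_le => // x Ux; exists n.
- move=> A [mA A_le SA] A_lt.
  have [B [mB AB AltB B_le SB]] :=
    almost_invariant_enlarge Taction small Gam delta_le mA A_lt SA.
  by exists B; split.
- split; [exact: measurable0|by rewrite rmeasure0|].
  by rewrite /spread; under eq_bigcupr do rewrite preimage_set0;
     rewrite bigcup0// set0D.
- have CE : rmeasure m C = delta by apply/eqP; rewrite eq_le C_le.
  exists C; split=> //; rewrite (rmeasureDI m (spreadP _ mC) mC) -CE.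
  have : rmeasure m (spread T S C `&` C) <= rmeasure m C.
    by apply: rmeasure_le => //; apply: measurableI => //; exact: spreadP.
  by move: SC; lra.
Qed.

(** On [C] the average vanishes, so its deviation from [m A] has absolute value [m A]. *)
Lemma Lnorm1_average_ge (A C : set X) (K : {fset G}) (w : G -> R) :
  measurable A -> measurable C -> spread T K C `<=` ~` A ->
  ((rmeasure m A * rmeasure m C)%:E <=
    'N[m]_1 [EFin \o (fun x => (\sum_(g <- K) w g * koopman T g \1_A x)
      - fine (m A))%R])%E.
Proof.
move=> mA mC KC; rewrite Lnorm1 -/(rmeasure m A).
set f := EFin \o _.
have mf : measurable_fun [set: X] f.
  apply/measurable_EFinP; apply: measurable_funB => //.
  apply: measurable_sum => g; apply: measurable_funM => //.
  apply: (@measurableT_comp _ _ _ _ _ _ (\1_A : X -> R)).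
    exact: measurable_indic.
  exact: (mp_act_measurable Taction).
apply: (@le_trans _ _ (\int[m]_(x in C) `|f x|)%E); last first.
  by apply: ge0_subset_integral => //; exact: measurableT_comp.
rewrite (eq_integral (fun=> (rmeasure m A)%:E)).
  by rewrite integral_cst// EFinM (rmeasureE m mC).
move=> x; rewrite inE => Cx; rewrite /f/= big_seq big1 ?sub0r.
  by rewrite normrN ger0_norm// rmeasure_ge0.
move=> g gK; rewrite /koopman indicE memNset ?mulr0//.
by apply: KC; exists g => //=; rewrite (action_cancelV Taction).
Qed.

End AlmostInvariantSet.

Lemma infinite_set_unbounded (J : set nat) :
  (forall n, exists2 j, J j & (n <= j)%N) -> infinite_set J.
Proof.
move=> J_unb /finite_seqP[s Js].
have [j Jj] := J_unb (\max_(i <- s) i).+1.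
have js : j \in s by move: Jj; rewrite Js.
by rewrite ltnNge => /negP; apply; exact: leq_bigmax_seq.
Qed.

Theorem theorem2 (R : realType) (a : nat -> R)
    (a_gt0 : forall j, 0 < a j) (a_cvg0 : a j @[j --> \oo] --> (0 : R))
    (d : measure_display) (X : measurableType d) (m : probability X R)
    (Xstd : standard_probability m)
    (G : groupType) (Gcountable : countable [set: G])
    (Ginfinite : infinite_set [set: G]) (Gamenable : amenable G R)
    (T : G -> X -> X) (Taction : mp_action m T)
    (Tfree : free_action m T) (Tergodic : ergodic_action m T)
    (F : nat -> {fset G}) (F_neq0 : forall j, F j != fset0) :
  forall (A' : set X) (eps : R),
    measurable A' -> (0 < m A')%E -> 0 < eps ->
    exists A : set X,
      [/\ measurable A,
          (m (A' `+` A) < eps%:E)%E &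
          forall w : nat -> G -> R,
            (forall j g, g \in F j -> 0 <= w j g) ->
            (forall j, \sum_(g <- F j) w j g = 1) ->
            infinite_set [set j : nat |
              ((a j)%:E <
                 'N[m]_1 [EFin \o (fun x => (\sum_(g <- F j)
                   w j g * koopman T g \1_A x) - fine (m A))%R])%E]].
Proof.
move=> A' eps mA' A'_gt0 eps_gt0.
have small : atomless m.
  move=> D eta; apply: (standard_atomless Xstd).
  exact: (free_action_point_null Taction).
pose p := rmeasure m A'.
have p_gt0 : 0 < p by rewrite -lte_fin rmeasureE.
have p_le1 : p <= 1 by rewrite -(rmeasureT m); exact: rmeasure_le.
pose b := Num.min eps p.
have b_gt0 : 0 < b by rewrite lt_min eps_gt0.
have [b_eps b_p] : b <= eps /\ b <= p by rewrite !ge_min !lexx orbT.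
(* The sets removed have measures at most [2 * delta k], adding up to at most [b / 2]:
   less than [eps], and at most half of the measure of [A']. *)
pose delta k : R := b / 8 / 2 ^+ k.
have delta_gt0 k : 0 < delta k by rewrite !divr_gt0// exprn_gt0.
have delta_le k : delta k <= 1 / 2.
  rewrite ler_pdivrMr ?exprn_gt0//.
  have : 1 <= 2 ^+ k :> R by rewrite exprn_ege1// ler1n.
  by move: (le_trans b_p p_le1); lra.
have /choice[jC jCP] : forall k, exists jC : nat * set X,
    [/\ (k <= jC.1)%N, a jC.1 < p / 2 * delta k, measurable jC.2,
        rmeasure m jC.2 = delta k & rmeasure m (spread T (F jC.1) jC.2) <= 2 * delta k].
  move=> k.
  have [N _ aN] : \forall j \near \oo, a j < p / 2 * delta k.
    by apply: cvgr_lt a_cvg0 _ _; rewrite mulr_gt0// divr_gt0.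
  pose j := maxn k N.
  have [C [mC CE SC]] :=
    almost_invariant_set Taction (F j) small Gamenable (ltW (delta_gt0 k)) (delta_le k).
  by exists (j, C); split=> //=; [exact: leq_maxl|apply: aN; exact: leq_maxr].
pose B k := spread T (F (jC k).1) (jC k).2.
have mB k : measurable (B k).
  by apply: (measurable_spread Taction); case: (jCP k).
pose fix U n := if n is k.+1 then U k `|` B k else set0.
have mU n : measurable (U n).
  by elim: n => [|n IHn] /=; [exact: measurable0|exact: measurableU].
pose V := \bigcup_n U n.
have mV : measurable V by exact: bigcupT_measurable.
have BV k : B k `<=` V by move=> x Bx; exists k.+1 => //; right.
have V_le : rmeasure m V <= b / 2.
  apply: rmeasure_nondecreasing_bigcup_le => // [n x Ux|n]; first by left.
  (* [4 * delta n] is the tail of the geometric series of the [2 * delta k]. *)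
  suff : rmeasure m (U n) <= b / 2 - 4 * delta n by move: (delta_gt0 n); lra.
  elim: n => [|n IHn]; first by rewrite rmeasure0 /delta expr0; lra.
  rewrite /= rmeasureUD//.
  have -> : delta n.+1 = delta n / 2 by rewrite /delta exprSr invfM mulrA.
  have : rmeasure m (B n `\` U n) <= rmeasure m (B n).
    by apply: rmeasure_le; [exact: measurableD|exact: mB|move=> x []].
  by have [_ _ _ _] := jCP n; rewrite -/(B n); lra.
have mA : measurable (A' `\` V) by exact: measurableD.
have A_ge : p / 2 <= rmeasure m (A' `\` V).
  have : rmeasure m (A' `&` V) <= rmeasure m V.
    by apply: rmeasure_le => //; exact: measurableI.
  by have := rmeasureDI m mA' mV; rewrite -/p; lra.
exists (A' `\` V); split=> //.
  apply: (@le_lt_trans _ _ (rmeasure m V)%:E).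
    rewrite rmeasureE//; apply: le_measure; rewrite ?inE//.
      by apply: measurableU; exact: measurableD.
    move=> x [[A'x nAx]|[[A'x _] //]].
    by apply: contrapT => nVx; apply: nAx.
  by rewrite lte_fin; lra.
move=> w _ _; apply: infinite_set_unbounded => k.
have [k_j aj mC CE _] := jCP k; exists (jC k).1 => //=.
apply: lt_le_trans (Lnorm1_average_ge Taction (w (jC k).1) mA mC _); last first.
  by move=> x /BV Vx [].
rewrite lte_fin CE; apply: lt_le_trans aj _.
by rewrite ler_pM2r.
Qed.
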